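(* Let $\mathcal{P}=\{P_k,\ k\ge1\}$ be the set of probability measures on $\mathbb{Z}$ given by $P_k(\{0\})=1-\frac1{k^2}$, $P_k(\{k\})=P_k(\{-k\})=\frac1{2k^2}$, and let $X(n)=n$ for $n\in\mathbb{Z}$ (so that $\mathbb{E}^{\mathcal{P}}[X]=\mathbb{E}^{\mathcal{P}}[-X]=0$ and $\mathbb{E}^{\mathcal{P}}[X^2]=-\mathbb{E}^{\mathcal{P}}[-X^2]=1$). Let $\{X_n\}_{n=1}^\infty$ be an i.i.d. sequence under a sublinear expectation $\mathbb{E}$ such that each $X_n$ has the same distribution as $X$. Let $\varphi(x)=1-|x|$. Then for all $n\in\mathbb{N}$, $$\mathbb{E}\Big[\varphi\Big(\frac{X_1+\cdots+X_n}{\sqrt n}\Big)\Big]=1,$$ and thus the central limit theorem does not hold: $\mathbb{E}[\varphi((X_1+\cdots+X_n)/\sqrt n)]$ does not converge to the expectation of $\varphi(\xi)$, where $\xi$ is a (classical) standard normal random variable.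
   Context: For a set $\mathcal{Q}$ of probability measures on a measurable space $(\Omega,\mathcal{F})$ and a random variable $Z$, $\mathbb{E}^{\mathcal{Q}}[Z]:=\sup_{P\in\mathcal{Q}}E_P[Z]$; $(\Omega,\mathcal{F},\mathcal{Q})$ is called a sublinear expectation space. The sequence $\{X_n\}$ lives on such a space and $\mathbb{E}$ is the corresponding upper expectation; the paper constructs such a sequence from $X$ and uses the same symbol for both sublinear expectations. $C_{b,Lip}(\mathbb{R}^m)$ is the set of bounded Lipschitz functions on $\mathbb{R}^m$. Two random variables (possibly on different sublinear expectation spaces) are identically distributed if their respective upper expectations of $\psi(\cdot)$ coincide for every $\psi\in C_{b,Lip}(\mathbb{R})$. The sequence $\{X_n\}$ is independent (Peng) if for each $n\in\mathbb{N}$ and each $\psi\in C_{b,Lip}(\mathbb{R}^{n+1})$, $\mathbb{E}[\psi(X_1,\dots,X_{n+1})]=\mathbb{E}\big[\mathbb{E}[\psi(x_1,\dots,x_n,X_{n+1})]|_{(x_1,\dots,x_n)=(X_1,\dots,X_n)}\big]$. I.i.d. means independent and identically distributed in these senses. *)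

(* Defs.v *)
From HB Require Import structures.
From mathcomp Require Import all_boot all_order all_algebra.
From mathcomp Require Import all_classical all_reals all_analysis.
Set Implicit Arguments.
Unset Strict Implicit.
Unset Printing Implicit Defensive.
Import Order.TTheory GRing.Theory Num.Theory.
Import numFieldNormedType.Exports.

Local Open Scope classical_set_scope.
Local Open Scope ring_scope.

Section SublinearExpectation.
Context {R : realType}.

Definition upper_expectation d (T : measurableType d)
    (Q : set (probability T R)) (Z : T -> R) : \bar R :=
  ereal_sup [set 'E_P[Z] | P in Q]%E.

Definition Cb_Lip (V : normedModType R) : set (V -> R^o) :=
  [set psi | bounded_fun psi /\ lipschitz psi].

Definition identically_distributed
    d (T : measurableType d) (Q : set (probability T R)) (Y : {mfun T >-> R})
    d' (T' : measurableType d') (Q' : set (probability T' R))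
    (Y' : {mfun T' >-> R}) : Prop :=
  forall psi, Cb_Lip (V := R^o) psi ->
    upper_expectation Q (fun w => psi (Y w)) =
    upper_expectation Q' (fun w => psi (Y' w)).

Definition row_rcons n (x : 'rV[R]_n) (y : R) : 'rV[R]_n.+1 :=
  \row_i oapp (x ord0) y (unlift ord_max i).

(* Sequences are indexed from 0: the function X i below is the (i+1)-st term
   of the sequence, so that X n plays the role of X_{n+1}. The inner upper
   expectation is that of a bounded function, hence finite (for nonempty Q);
   [fine] only turns it into a real number. *)
Definition peng_independent d (T : measurableType d)
    (Q : set (probability T R)) (X : nat -> {mfun T >-> R}) : Prop :=
  forall n, (0 < n)%N -> forall psi, Cb_Lip (V := 'rV[R]_n.+1) psi ->
    upper_expectation Q (fun w => psi (\row_(i < n.+1) X i w)) =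
    upper_expectation Q (fun w =>
      (fun x : 'rV[R]_n =>
         fine (upper_expectation Q (fun w' => psi (row_rcons x (X n w')))))
      (\row_(i < n) X i w)).

Definition peng_iid d (T : measurableType d)
    (Q : set (probability T R)) (X : nat -> {mfun T >-> R}) : Prop :=
  peng_independent Q X /\
  forall i j, identically_distributed Q (X i) Q (X j).

End SublinearExpectation.

HB.instance Definition _ := isPointed.Build int 0.

HB.instance Definition _ := @isMeasurable.Build default_measure_display
  int discrete_measurable discrete_measurable0
  discrete_measurableC discrete_measurableU.

Section Example.
Context {R : realType}.

(* Meant for k >= 1; at k = 0, since 0^-1 = 0, this is the Dirac mass at 0. *)
Definition Pk (k : nat) : set int -> \bar R := fun A =>
  ((1 - (k%:R ^+ 2)^-1)%:E * dirac (0%R : int) A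
   + (2 * k%:R ^+ 2)^-1%:E * dirac (k%:Z) A
   + (2 * k%:R ^+ 2)^-1%:E * dirac (- k%:Z)%R A)%E.

Section Pk_probability.
Variable k : nat.

Let c0_ge0 : 0 <= 1 - (k%:R ^+ 2)^-1 :> R.
Proof.
rewrite subr_ge0; case: k => [|m]; first by rewrite expr0n invr0 ler01.
by rewrite invf_le1 ?exprn_gt0 ?ltr0n// exprn_ege1// ler1n.
Qed.

Let c1_ge0 : 0 <= (2 * k%:R ^+ 2)^-1 :> R.
Proof. by rewrite invr_ge0 mulr_ge0// exprn_ge0. Qed.

Let mix : {measure set int -> \bar R} :=
  measure_add (measure_add (mscale (NngNum c0_ge0) (dirac (0 : int)))
                           (mscale (NngNum c1_ge0) (dirac k%:Z)))
              (mscale (NngNum c1_ge0) (dirac (- k%:Z))).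

Let PkE : Pk k = mix.
Proof.
apply/funext => A.
by rewrite /= /measure_add /msum /= !big_ord_recl !big_ord0 /= /measure_add
  /msum !big_ord_recl !big_ord0 /mscale /= !adde0.
Qed.

Let Pk0 : Pk k set0 = 0%E. Proof. by rewrite PkE measure0. Qed.

Let Pk_ge0 A : (0 <= Pk k A)%E. Proof. by rewrite PkE measure_ge0. Qed.

Let Pk_sigma_additive : semi_sigma_additive (Pk k).
Proof. by rewrite PkE; exact: measure_semi_sigma_additive. Qed.

HB.instance Definition _ := isMeasure.Build _ _ _ (Pk k)
  Pk0 Pk_ge0 Pk_sigma_additive.

Let Pk_setT : Pk k setT = 1%E.
Proof.
rewrite /Pk !diracT !mule1 -!EFinD; congr EFin.
rewrite -addrA (_ : (2 * _)^-1 + _ = (k%:R ^+ 2)^-1) ?subrK//.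
by rewrite (invfM 2) -mulr2n -mulrnAl -[2^-1 *+ 2]mulr_natl divff ?mul1r// pnatr_eq0.
Qed.

HB.instance Definition _ :=
  @Measure_isProbability.Build _ _ R (Pk k) Pk_setT.

End Pk_probability.

Definition calP : set (probability int R) :=
  [set (Pk k : probability int R) | k in [set k | (1 <= k)%N]].

Definition Xint (n : int) : R := n%:~R.

Let measurable_Xint : measurable_fun [set: int] Xint.
Proof. by []. Qed.

HB.instance Definition _ :=
  isMeasurableFun.Build _ _ int R Xint measurable_Xint.

Definition phi (x : R) : R := 1 - `|x|.

Definition normalized_sum d (T : measurableType d) (X : nat -> {mfun T >-> R})
    (n : nat) (w : T) : R :=
  (\sum_(i < n) X i w) / Num.sqrt n%:R.

End Example.

(* Main.v *)
Require Import Defs.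
From HB Require Import structures.
From mathcomp Require Import all_boot all_order all_algebra.
From mathcomp Require Import all_classical all_reals all_analysis.
From mathcomp Require Import measurable_realfun ring lra.
Set Implicit Arguments.
Unset Strict Implicit.
Unset Printing Implicit Defensive.
Import Order.TTheory GRing.Theory Num.Theory.
Import numFieldNormedType.Exports.

Local Open Scope classical_set_scope.
Local Open Scope ring_scope.

(** The sublinear second moments of the [X i] are those of a variable of
    variance one, but the mass producing them escapes: under [Pk k] one has
    [E|X| = 1/k] while [E[X^2] = 1].  So the lower expectation of [|X|] is zero,
    and by independence that of [|X_1| + ... + |X_n|] should be zero as well.
    Since [phi] is one minus an absolute value, its upper expectation at the
    normalized sum is one minus a lower expectation, namely that of the
    absolute value of the normalized sum, which is squeezed to zero.

    The difficulty is that [|x|] is not bounded, whereas equality in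
    distribution and independence only speak about bounded Lipschitz
    functions.  It is handled by truncation.  Let [trunc_abs M x] be the minimum
    of [|x|] and [M].
    - Independence applies to the sums of the [trunc_abs M (X i)], and shows by
      induction that some [P] in [Q] makes the expectation of the sum
      arbitrarily small ([upper_expectation_sum_trunc_abs]).
    - The tail is controlled uniformly over [Q]: testing against the squares of
      the [trunc_abs M] and letting [M] grow gives [E_P[X_i^2] <= 1] for each
      single [P] in [Q] ([expectation_sqr_le1]), and
      [|x| <= trunc_abs M x + x^2 / M] ([abs_le_trunc_abs]).
    Choosing [M] of order [n / e] and then [P] gives
    [upper_expectation_phi_normalized_sum].

    For the limit, [E[1 - |xi|] = 1] would force [E|xi| = 0], that is [xi = 0]
    almost surely, while a normal law has no atom
    ([normal_abs_expectation_neq0]). *)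

(** * Expectations of nonnegative variables *)

(** Linearity without integrability: only the upper bound [c] on [c - W] is
    needed for the formula to make sense, and both sides are [-oo] when [W] is
    not integrable.  This is what allows unbounded [W], such as the absolute
    value of the normalized sum, under an arbitrary [P]. *)
Lemma expectation_cB d (T : measurableType d) (R : realType) (P : probability T R)
   (W : T -> R) (c : R) : measurable_fun setT W -> (forall w, 0 <= W w) ->
  ('E_P[fun w => (c - W w)%R] = c%:E - 'E_P[W])%E.
Proof.
move=> mW W0; rewrite unlock integralE.
set f := fun w => (c - W w)%:E.
have mf : measurable_fun setT f.
  by apply/measurable_EFinP; apply: measurable_funB.
have cstE (a : R) : (\int[P]_w a%:E)%E = a%:E.
  by rewrite integral_cst// [X in (_ * X)%E]probability_setT mule1.
have fp0 w : (0 <= f^\+ w)%E by exact: funepos_ge0.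
have fn0 w : (0 <= f^\- w)%E by exact: funeneg_ge0.
have mp := measurable_funepos mf.
have mn := measurable_funeneg mf.
have mWE : measurable_fun setT (EFin \o W) by exact/measurable_EFinP.
have W0E w : (0 <= (W w)%:E)%E by rewrite lee_fin.
have cp0 : (0 <= (Num.max c 0)%:E)%E by rewrite lee_fin le_max lexx orbT.
have cn0 : (0 <= (Num.max (- c) 0)%:E)%E by rewrite lee_fin le_max lexx orbT.
(* The identity f = c - W is rearranged into an equality of sums of nonnegative
   functions, which can be integrated termwise. *)
have : (\int[P]_w (f^\+ w + ((W w)%:E + (Num.max (- c) 0)%:E)) =
        \int[P]_w (f^\- w + (Num.max c 0)%:E))%E.
  apply: eq_integral => w _; rewrite /f funeposE funenegE -!EFin_max -!EFinD; congr EFin.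
  by rewrite !maxEle; repeat case: ifP; lra.
rewrite ge0_integralD//; [|by move=> w _; apply: adde_ge0..|by apply: emeasurable_funD].
rewrite ge0_integralD// ge0_integralD// !cstE.
have fpfin : (\int[P]_w f^\+ w)%E \is a fin_num.
  rewrite ge0_fin_numE; last exact: integral_ge0.
  apply: (@le_lt_trans _ _ (\int[P]_w (Num.max c 0)%:E)%E); last by rewrite cstE ltry.
  apply: ge0_le_integral => // w _; rewrite funeposE /f -EFin_max lee_fin.
  by have := W0 w; rewrite !maxEle; repeat case: ifP; lra.
have : (0 <= \int[P]_w f^\- w)%E by exact: integral_ge0.
have : (0 <= \int[P]_w (W w)%:E)%E by exact: integral_ge0.
rewrite -/(f) -(fineK fpfin).
move: (\int[P]_w (W w)%:E)%E (\int[P]_w f^\- w)%E => [a| |] [b| |]//= _ _.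
rewrite -!EFinD => -[h]; congr EFin; move: h.
by rewrite !maxEle; repeat case: ifP; lra.
Qed.

Lemma ge0_le_expectation d (T : measurableType d) (R : realType) (P : probability T R)
   (V W : T -> R) : measurable_fun setT V -> measurable_fun setT W ->
   (forall w, 0 <= V w) -> (forall w, V w <= W w) ->
  ('E_P[V] <= 'E_P[W])%E.
Proof.
move=> mV mW V0 VW; rewrite unlock; apply: ge0_le_integral => //.
- by move=> w _; rewrite lee_fin.
- exact/measurable_EFinP.
- exact/measurable_EFinP.
- by move=> w _; rewrite lee_fin.
Qed.

(** * Upper expectations *)

(** The right-hand side says that the lower expectation of [W] vanishes, and
    does not mention [c]: the value at one [c] gives the value at every [c].
    It also compares well with inequalities between the [W]s. *)
Lemma upper_expectation_cBP d (T : measurableType d) (R : realType)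
   (Q : set (probability T R)) (W : T -> R) (c : R) :
   measurable_fun setT W -> (forall w, 0 <= W w) ->
   upper_expectation Q (fun w => (c - W w)%R) = c%:E <->
   forall e, 0 < e -> exists2 P, Q P & ('E_P[W] < e%:E)%E.
Proof.
move=> mW W0.
have W0E P : (0 <= 'E_P[W])%E by apply: expectation_ge0.
split=> [Qc e e0|QW].
  have : ((c - e)%:E < upper_expectation Q (fun w => (c - W w)%R))%E.
    by rewrite Qc lte_fin gtrBl.
  move/ereal_sup_gt => [_ [P QP <-]]; rewrite expectation_cB// => Pe.
  exists P => //; move: Pe (W0E P).
  case: ('E_P[W])%E => [a| |]//=; rewrite -EFinB !lte_fin => ? _; lra.
apply/eqP; rewrite eq_le; apply/andP; split.
  apply: ge_ereal_sup => _ [P _ <-]; rewrite expectation_cB//.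
  move: (W0E P); case: ('E_P[W])%E => [a| |]//=; last by rewrite leNye.
  by rewrite -EFinB !lee_fin => ?; lra.
apply/lee_addgt0Pr => e e0.
have [P QP] := QW _ e0.
have : ('E_P[fun w => (c - W w)%R] <= upper_expectation Q (fun w => (c - W w)%R))%E.
  by apply: ereal_sup_ubound; exists P.
rewrite expectation_cB//; move: (W0E P).
case: ('E_P[W])%E => [a| |]//= _ h1; rewrite lte_fin => h2.
apply: (@le_trans _ _ (c%:E - a%:E + e%:E)%E); last by rewrite leeD2r.
by rewrite -EFinB -EFinD lee_fin; lra.
Qed.

Lemma expectation_le_upper d (T : measurableType d) (R : realType)
    (Q : set (probability T R)) (Z : T -> R) (P : probability T R) :
  Q P -> ('E_P[Z] <= upper_expectation Q Z)%E.
Proof. by move=> QP; apply: ereal_sup_ubound; exists P. Qed.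

(** * Truncated absolute values as test functions *)

Lemma Cb_LipI (R : realType) (V : normedModType R) (psi : V -> R^o) (B L : R) :
  (forall x, `|psi x| <= B) -> (forall x y, `|psi x - psi y| <= L * `|x - y|) ->
  Cb_Lip psi.
Proof.
move=> psiB psiL; split.
  exists B; split; first exact: num_real.
  by move=> M /ltW BM x _ /=; apply: le_trans BM.
exists L; split; first exact: num_real.
by move=> M /ltW LM [x y] _ /=; apply: le_trans (psiL x y) _; rewrite ler_wpM2r.
Qed.

Definition trunc_abs (R : realType) (M x : R) : R := Num.min `|x| M.

Section TruncAbs.
Context {R : realType}.
Implicit Types (M x y : R).

Lemma trunc_abs_ge0 M x : 0 <= M -> 0 <= trunc_abs M x.
Proof. by move=> M0; rewrite /trunc_abs le_min normr_ge0. Qed.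

Lemma trunc_abs_le M x : trunc_abs M x <= M.
Proof. by rewrite /trunc_abs ge_min lexx orbT. Qed.

Lemma trunc_abs_le_abs M x : trunc_abs M x <= `|x|.
Proof. by rewrite /trunc_abs ge_min lexx. Qed.

Lemma trunc_abs_lip M x y : `|trunc_abs M x - trunc_abs M y| <= `|x - y|.
Proof.
have := lerB_dist x y; have := lerB_dist y x; rewrite (distrC y x) /trunc_abs.
by rewrite !minElt ler_norml; repeat case: ifP; move=> *; apply/andP; split; lra.
Qed.

Lemma measurable_trunc_abs M : measurable_fun setT (trunc_abs M).
Proof. by apply: measurable_minr => //; apply: normr_measurable. Qed.

(** Trades the unbounded [|x|] for a bounded function and a second moment whose
    weight can be made small. *)
Lemma abs_le_trunc_abs M x : 0 < M -> `|x| <= trunc_abs M x + M^-1 * x ^+ 2.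
Proof.
move=> M0; rewrite /trunc_abs -real_normK ?num_real//.
have x0 := normr_ge0 x; move: `|x| x0 => {x} a a0; rewrite minElt.
have M'0 : 0 <= M^-1 by rewrite invr_ge0 ltW.
case: ltP => [_|Ma]; first by rewrite lerDl mulr_ge0// exprn_ge0.
rewrite (@le_trans _ _ (M^-1 * a ^+ 2))//; last by rewrite lerDr ltW.
by rewrite mulrC ler_pdivlMr// expr2 ler_wpM2l.
Qed.

Lemma Cb_Lip_trunc_abs_sqr M : 0 <= M ->
  Cb_Lip (V := R^o) (fun x : R => trunc_abs M x ^+ 2 : R^o).
Proof.
move=> M0; apply: (@Cb_LipI _ _ _ (M ^+ 2) (2 * M)) => [x|x y].
  rewrite ger0_norm ?exprn_ge0 ?trunc_abs_ge0//.
  by rewrite lerXn2r ?nnegrE ?trunc_abs_ge0 ?trunc_abs_le.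
rewrite subr_sqr normrM mulrC ler_pM//; last exact: trunc_abs_lip.
rewrite ger0_norm ?addr_ge0 ?trunc_abs_ge0//.
by have := trunc_abs_le M x; have := trunc_abs_le M y; lra.
Qed.

Lemma Cb_Lip_trunc_abs M : 0 <= M ->
  Cb_Lip (V := R^o) (fun x : R => 0 - trunc_abs M x : R^o).
Proof.
move=> M0; apply: (@Cb_LipI _ _ _ M 1) => [x|x y].
  by rewrite sub0r normrN ger0_norm ?trunc_abs_le ?trunc_abs_ge0.
by rewrite !sub0r -opprD normrN mul1r; apply: trunc_abs_lip.
Qed.

Lemma Cb_Lip_sum_trunc_abs n M : 0 <= M ->
  Cb_Lip (V := 'rV[R]_n.+1)
    (fun x : 'rV[R]_n.+1 => 0 - \sum_(i < n.+1) trunc_abs M (x ord0 i) : R^o).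
Proof.
move=> M0; apply: (@Cb_LipI _ _ _ (\sum_(i < n.+1) M) n.+1%:R) => [x|x y].
  rewrite sub0r normrN (le_trans (ler_norm_sum _ _ _))// ler_sum// => i _.
  by rewrite ger0_norm ?trunc_abs_le ?trunc_abs_ge0.
rewrite !sub0r -opprD normrN -sumrB (le_trans (ler_norm_sum _ _ _))//.
rewrite (@le_trans _ _ (\sum_(i < n.+1) `|x - y|))//; last first.
  by rewrite sumr_const card_ord mulr_natl.
apply: ler_sum => i _; apply: (le_trans (trunc_abs_lip _ _ _)).
by have := mx_normrE (x - y); rewrite [leRHS]/Num.Def.normr/= => ->;
  rewrite (le_trans _ (le_bigmax _ _ (ord0, i)))// !mxE.
Qed.

End TruncAbs.

(** * The mixtures [Pk k] *)

Lemma ge0_integral_Pk (R : realType) (k : nat) (f : int -> R) :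
  (0 < k)%N -> (forall n, 0 <= f n) ->
  (\int[Pk (R := R) k]_n (f n)%:E =
   ((1 - (k%:R ^+ 2)^-1) * f 0
    + (2 * k%:R ^+ 2)^-1 * (f k%:Z + f (- k%:Z)))%:E)%E.
Proof.
move=> k0 f0.
have a0 : 0 <= 1 - (k%:R ^+ 2)^-1 :> R.
  by rewrite subr_ge0 invf_le1 ?exprn_gt0 ?ltr0n// exprn_ege1// ler1n.
have b0 : 0 <= (2 * k%:R ^+ 2)^-1 :> R by rewrite invr_ge0 mulr_ge0// exprn_ge0.
have mf : measurable_fun [set: int] (EFin \o f) by [].
have f0E (n : int) : [set: int] n -> (0 <= (EFin \o f) n)%E.
  by move=> _; rewrite lee_fin.
pose mix := measure_add
  (measure_add (mscale (NngNum a0) (dirac (0 : int)))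
               (mscale (NngNum b0) (dirac k%:Z)))
  (mscale (NngNum b0) (dirac (- k%:Z))).
rewrite (eq_measure_integral mix); last first.
  move=> A _ _; rewrite /mix /= /measure_add /msum !big_ord_recl !big_ord0 /=.
  by rewrite /measure_add /msum !big_ord_recl !big_ord0 /mscale /= !adde0.
rewrite /mix ge0_integral_measure_add// ge0_integral_measure_add//.
rewrite !ge0_integral_mscale// !integral_dirac// !diracT !mul1e /=.
by rewrite -!EFinM -!EFinD mulrDr addrA.
Qed.

Lemma expectation_Pk (R : realType) (k : nat) (f : int -> R) :
  (0 < k)%N ->
  ('E_(Pk (R := R) k)[f] =
   ((1 - (k%:R ^+ 2)^-1) * f 0
    + (2 * k%:R ^+ 2)^-1 * (f k%:Z + f (- k%:Z)))%:E)%E.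
Proof.
move=> k0; rewrite unlock integralE.
under eq_integral do rewrite funeposE -EFin_max.
under [X in (_ - X)%E]eq_integral do rewrite funenegE -EFinN -EFin_max.
rewrite (@ge0_integral_Pk _ _ (fun n => Num.max (f n) 0))//; last first.
  by move=> n; rewrite le_max lexx orbT.
rewrite (@ge0_integral_Pk _ _ (fun n => Num.max (- f n) 0))//; last first.
  by move=> n; rewrite le_max lexx orbT.
have E x : Num.max x 0 - Num.max (- x) 0 = x :> R.
  by rewrite !maxEle; repeat case: ifP; lra.
rewrite -EFinB; congr EFin.
rewrite -[in RHS](E (f 0)) -[in RHS](E (f k%:Z)) -[in RHS](E (f (- k%:Z))).
ring.
Qed.

Lemma upper_expectation_calP_const (R : realType) (f : int -> R) (c : R) :
  (forall k, (0 < k)%N -> 'E_(Pk (R := R) k)[f] = c%:E)%E ->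
  upper_expectation calP f = c%:E.
Proof.
move=> fc; rewrite /upper_expectation (_ : [set _ | _ in _] = [set c%:E]).
  exact: ereal_sup1.
apply/seteqP; split => [_ [_ [k k0 <-] <-]|_ ->]; first exact: fc.
by exists (Pk 1 : probability int R); [exists 1%N|exact: fc].
Qed.

Lemma expectation_Pk_sqr (R : realType) (k : nat) : (0 < k)%N ->
  ('E_(Pk (R := R) k)[fun n => (Xint n ^+ 2)%R] = 1)%E.
Proof.
move=> k0; rewrite expectation_Pk// /Xint; congr EFin.
have k0' : k%:R != 0 :> R by rewrite pnatr_eq0 -lt0n.
by rewrite mulrNz sqrrN expr0n/= mulr0 add0r -pmulrn; field.
Qed.

(** * Consequences of being distributed as [Xint] under [calP] *)

Section CopyOfX.
Context {R : realType} d (T : measurableType d)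
  (Q : set (probability T R)) (Y : {mfun T >-> R})
  (distY : identically_distributed Q Y calP Xint).

Lemma expectation_trunc_sqr_le1 P M : Q P -> 0 <= M ->
  ('E_P[fun w => (trunc_abs M (Y w) ^+ 2)%R] <= 1)%E.
Proof.
move=> QP M0; apply: le_trans (expectation_le_upper _ QP) _.
rewrite (distY (Cb_Lip_trunc_abs_sqr M0)).
apply: ge_ereal_sup => _ [_ [k k0 <-] <-].
rewrite -(expectation_Pk_sqr R k0); apply: ge0_le_expectation => //.
- by move=> w; rewrite exprn_ge0// trunc_abs_ge0.
- move=> w; rewrite -(real_normK (num_real (Xint w))).
  by rewrite lerXn2r ?nnegrE ?trunc_abs_ge0// trunc_abs_le_abs.
Qed.

(** The square is not a bounded function, but its truncations are increasing
    bounded Lipschitz functions, so monotone convergence under each single [P]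
    carries the bound over. *)
Lemma expectation_sqr_le1 P : Q P -> ('E_P[fun w => (Y w ^+ 2)%R] <= 1)%E.
Proof.
move=> QP.
pose g (m : nat) w : \bar R := (trunc_abs m%:R (Y w) ^+ 2)%:E.
have mg m : measurable_fun setT (g m).
  apply/measurable_EFinP; apply: measurable_funX.
  by apply: measurableT_comp => //; exact: measurable_trunc_abs.
have g0 m w : [set: T] w -> (0 <= g m w)%E.
  by move=> _; rewrite lee_fin exprn_ge0// trunc_abs_ge0.
have ndg w : [set: T] w -> {homo g^~ w : m n / (m <= n)%N >-> (m <= n)%E}.
  move=> _ m n mn; rewrite lee_fin lerXn2r ?nnegrE ?trunc_abs_ge0//.
  by rewrite /trunc_abs le_min !ge_min lexx/= ler_nat mn orbT.
have limg w : limn (g^~ w) = (Y w ^+ 2)%:E.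
  apply/cvg_lim => //; apply: cvg_near_cst.
  near=> m; rewrite /g /trunc_abs min_l ?real_normK ?num_real//.
  by near: m; exact: nbhs_infty_ger.
have := cvg_monotone_convergence (mu := P) measurableT mg g0 ndg.
under [X in _ --> X -> _]eq_integral do rewrite limg.
move=> h; rewrite unlock -(cvg_lim _ h)//.
apply: lime_le; first by apply/cvg_ex; eexists; exact: h.
near=> m; have := @expectation_trunc_sqr_le1 P m%:R QP.
by rewrite unlock => ->.
Unshelve. all: by end_near. Qed.

(** Under [Pk k] the expectation of [|Xint|] is [1/k], so the lower expectation
    of [trunc_abs M] vanishes.  A general constant [c] is needed because, in the
    use of independence, the terms with frozen arguments play its role. *)
Lemma upper_expectation_cB_trunc_abs M c : 0 <= M ->
  upper_expectation Q (fun w => (c - trunc_abs M (Y w))%R) = c%:E.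
Proof.
move=> M0.
have mtrunc d' (T' : measurableType d') (Z : {mfun T' >-> R}) :
    measurable_fun setT (fun w => trunc_abs M (Z w)).
  by apply: measurableT_comp => //; exact: measurable_trunc_abs.
have trunc0 d' (T' : measurableType d') (Z : T' -> R) w :
  0 <= trunc_abs M (Z w) by exact: trunc_abs_ge0.
apply/upper_expectation_cBP => //.
apply/(upper_expectation_cBP _ 0) => //.
rewrite (distY (Cb_Lip_trunc_abs M0)).
apply/upper_expectation_cBP => // e e0.
pose k := (Num.truncn e^-1).+1.
have ke : e^-1 < k%:R by exact: truncnS_gt.
have k0 : 0 < k%:R :> R by rewrite ltr0n.
exists (Pk k : probability int R); first by exists k.
rewrite expectation_Pk// lte_fin.
apply: (@le_lt_trans _ _ k%:R^-1); last by rewrite invf_plt ?posrE.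
have -> : trunc_abs M (@Xint R 0) = 0 by rewrite /trunc_abs normr0 min_l.
have h1 := trunc_abs_le_abs M (@Xint R k%:Z).
have h2 := trunc_abs_le_abs M (@Xint R (- k%:Z)).
rewrite /Xint mulrNz normrN -pmulrn normr_nat in h1 h2.
apply: (@le_trans _ _ ((2 * k%:R ^+ 2)^-1 * (k%:R + k%:R))).
  by rewrite mulr0 add0r ler_wpM2l ?invr_ge0 ?mulr_ge0 ?exprn_ge0// lerD// mulrNz -pmulrn.
by rewrite le_eqVlt; apply/orP; left; apply/eqP; field; rewrite gt_eqF.
Qed.
End CopyOfX.

(** Once the first arguments are frozen, the inner upper expectation replaces
    the last term by zero, so the terms are peeled off one at a time. *)
Lemma upper_expectation_sum_trunc_abs (R : realType) d (T : measurableType d)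
    (Q : set (probability T R)) (X : nat -> {mfun T >-> R}) M n :
  peng_independent Q X ->
  (forall i, identically_distributed Q (X i) calP Xint) -> 0 <= M ->
  (0 < n)%N ->
  upper_expectation Q
    (fun w => (0 - \sum_(i < n) trunc_abs M (X i w))%R) = 0%E.
Proof.
move=> indX distX M0; case: n => // n _; elim: n => [|n IHn].
  under [X in upper_expectation _ X]eq_fun do rewrite big_ord1.
  exact: upper_expectation_cB_trunc_abs.
have := indX n.+1 isT _ (@Cb_Lip_sum_trunc_abs _ n.+1 _ M0).
under eq_fun do under eq_bigr do rewrite mxE.
move=> ->; rewrite -[RHS]IHn; congr upper_expectation; apply/funext => w.
(* The inner upper expectation is the frozen part c of the sum minus a lower
   expectation which vanishes, so it equals c. *)
rewrite -[RHS]/(fine (_%:E)); congr fine.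
rewrite -(upper_expectation_cB_trunc_abs (distX n.+1) _ M0).
congr upper_expectation; apply/funext => w'.
rewrite big_ord_recr/= opprD addrA; congr (_ - _ - _).
  apply: eq_bigr => i _; congr (trunc_abs M _); rewrite mxE.
  have -> : widen_ord (leqnSn n.+1) i = lift ord_max i.
    by apply/val_inj; rewrite /= [RHS]lift_max.
  by rewrite liftK/= mxE.
by rewrite mxE unlift_none.
Qed.

(** * The normalized sum *)

Lemma abs_normalized_sum_le (R : realType) d (T : measurableType d)
    (X : nat -> {mfun T >-> R}) n M w : (0 < n)%N -> 0 < M ->
  `|normalized_sum X n w| <=
  \sum_(i < n) trunc_abs M (X i w) + M^-1 * \sum_(i < n) X i w ^+ 2.
Proof.
move=> n0 M0; have s1 : 1 <= Num.sqrt n%:R :> R.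
  by have := @ler_wsqrtr R 1 n%:R; rewrite sqrtr1 ler1n; exact.
rewrite /normalized_sum normrM normfV (ger0_norm (sqrtr_ge0 _)).
rewrite ler_pdivrMr ?(lt_le_trans ltr01)//.
rewrite mulr_sumr -big_split/= (@le_trans _ _ (\sum_(i < n) `|X i w|))//.
  exact: ler_norm_sum.
rewrite (@le_trans _ _ (\sum_(i < n) (trunc_abs M (X i w) + M^-1 * X i w ^+ 2)))//.
  by apply: ler_sum => i _; exact: abs_le_trunc_abs.
rewrite ler_peMr// sumr_ge0// => i _.
by rewrite (le_trans (normr_ge0 (X i w)))// abs_le_trunc_abs.
Qed.

(** The point is that the bound on the second moments holds for every [P] in
    [Q], hence for the [P] that makes the truncated sum small. *)
Lemma upper_expectation_phi_normalized_sum (R : realType) d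
    (T : measurableType d) (Q : set (probability T R))
    (X : nat -> {mfun T >-> R}) n :
  peng_independent Q X ->
  (forall i, identically_distributed Q (X i) calP Xint) -> (0 < n)%N ->
  upper_expectation Q (fun w => phi (normalized_sum X n w)) = 1%E.
Proof.
move=> indX distX n0.
have mabs : measurable_fun setT (fun w => `|normalized_sum X n w|).
  apply: measurableT_comp => //; apply: measurable_funM => //.
  by apply: measurable_sum => i.
apply/(@upper_expectation_cBP _ _ _ _ (fun w => `|normalized_sum X n w|)) => //.
move=> e e0.
(* With this M the second moments contribute at most n / M = e / 2. *)
pose M : R := 2 * n%:R / e.
have nR0 : 0 < n%:R :> R by rewrite ltr0n.
have M0 : 0 < M by rewrite divr_gt0// mulr_gt0.
have mtr i : measurable_fun setT (fun w => trunc_abs M (X i w)).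
  by apply: measurableT_comp => //; exact: measurable_trunc_abs.
have tr0 i w : 0 <= trunc_abs M (X i w) by apply: trunc_abs_ge0; exact: ltW.
have mS : measurable_fun setT (fun w => \sum_(i < n) trunc_abs M (X i w)).
  by apply: measurable_sum.
have S0 w : 0 <= \sum_(i < n) trunc_abs M (X i w) by rewrite sumr_ge0.
have mV : measurable_fun setT (fun w => M^-1 * \sum_(i < n) X i w ^+ 2).
  apply: measurable_funM => //; apply: measurable_sum => i.
  exact: measurable_funX.
have V0 w : 0 <= M^-1 * \sum_(i < n) X i w ^+ 2.
  by rewrite mulr_ge0 ?invr_ge0 ?(ltW M0)// sumr_ge0// => i _; exact: sqr_ge0.
have e20 : 0 < e / 2 by rewrite divr_gt0.
have [P QP PS] : exists2 P, Q P &
    ('E_P[fun w => (\sum_(i < n) trunc_abs M (X i w))%R] < (e / 2)%:E)%E.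
  move: e20; apply: (upper_expectation_cBP _ 0 mS S0).1.
  by apply: upper_expectation_sum_trunc_abs => //; exact: ltW.
exists P => //.
have PV : ('E_P[fun w => (M^-1 * \sum_(i < n) X i w ^+ 2)%R] <= (e / 2)%:E)%E.
  rewrite unlock.
  under eq_integral do rewrite EFinM -sumEFin.
  rewrite ge0_integralZl_EFin//; first last.
  - by rewrite invr_ge0 ltW.
  - by apply: emeasurable_sum => i; apply/measurable_EFinP; exact: measurable_funX.
  - by move=> w _; apply: sume_ge0 => i _; rewrite lee_fin sqr_ge0.
  rewrite ge0_integral_sum//; first last.
  - by move=> i w _; rewrite lee_fin sqr_ge0.
  - by move=> i; apply/measurable_EFinP; exact: measurable_funX.
  rewrite (_ : e / 2 = M^-1 * n%:R)%R; last by rewrite /M; field; rewrite !gt_eqF.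
  rewrite EFinM lee_pmul2l ?lte_fin ?invr_gt0//.
  apply: (@le_trans _ _ (\sum_(i < n) 1%:E)%E).
    apply: lee_sum => i _.
    by have := expectation_sqr_le1 (distX i) QP; rewrite unlock.
  by rewrite sumEFin lee_fin sumr_const card_ord.
apply: (@le_lt_trans _ _ ('E_P[fun w => (\sum_(i < n) trunc_abs M (X i w)
    + M^-1 * \sum_(i < n) X i w ^+ 2)%R])%E).
  apply: ge0_le_expectation => //; first exact: measurable_funD.
  by move=> w; exact: abs_normalized_sum_le.
rewrite (_ : e = e / 2 + e / 2)%R; last by field.
have -> : ('E_P[fun w => (\sum_(i < n) trunc_abs M (X i w)
    + M^-1 * \sum_(i < n) X i w ^+ 2)%R] =
    'E_P[fun w => (\sum_(i < n) trunc_abs M (X i w))%R]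
    + 'E_P[fun w => (M^-1 * \sum_(i < n) X i w ^+ 2)%R])%E.
  rewrite unlock -ge0_integralD//.
  - by move=> w _; rewrite lee_fin.
  - exact/measurable_EFinP.
  - by move=> w _; rewrite lee_fin.
  - exact/measurable_EFinP.
rewrite EFinD; apply: lte_leD => //.
rewrite ge0_fin_numE ?expectation_ge0//.
by rewrite (le_lt_trans PV) ?ltry.
Qed.

(** * The normal limit *)

(** A vanishing first absolute moment puts all the mass on the origin, which is
    null for the Lebesgue measure and so for the normal law. *)
Lemma normal_abs_expectation_neq0 (R : realType) d (T : measurableType d)
    (P : probability T R) (xi : {RV P >-> R}) :
  (forall A, measurable A -> distribution P xi A = normal_prob 0 1 A) ->
  ('E_P[fun w => `|xi w|%R])%E <> 0%E.
Proof.
move=> xiN Exi0.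
have mxi : measurable_fun setT (EFin \o xi) by apply/measurable_EFinP.
have : ae_eq P setT (EFin \o xi) (cst 0%E).
  apply/(ae_eq_integral_abs _ _ _).1 => //.
  by move: Exi0; rewrite unlock.
move=> [A [mA PA0 subA]].
have N0 : normal_prob 0 1 [set (0 : R)] = 0%E.
  exact: integral_set1.
have mxi0 : measurable (xi @^-1` [set 0%R]) by exact: measurable_funPTI.
have : (P setT <= P A + P (xi @^-1` [set 0%R]))%E.
  apply: le_trans (measureU2 _ _ _) => //.
  apply: le_measure; rewrite ?inE//; first exact: measurableU.
  move=> w _; have [xi0|/eqP xi0] := eqVneq (xi w) 0; first by right.
  by left; apply: subA => /= /(_ I) -[].
have := xiN [set (0 : R)] (measurable_set1 (0 : R)); rewrite /distribution /pushforward => ->.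
by rewrite PA0 N0 adde0 probability_setT lee_fin ler10.
Qed.

(** * The failure of the central limit theorem *)

Theorem proposition6p3 (R : realType) (d : measure_display)
    (Omega : measurableType d) (Q : set (probability Omega R))
    (X : nat -> {mfun Omega >-> R})
    (iidX : peng_iid Q X)
    (distX : forall i, identically_distributed Q (X i) calP Xint) :
  [/\ [/\ upper_expectation calP (Xint (R := R)) = 0%E,
          upper_expectation calP (fun n => - Xint (R := R) n) = 0%E,
          upper_expectation calP (fun n => Xint (R := R) n ^+ 2) = 1%E &
          (- upper_expectation calP (fun n => - (Xint (R := R) n ^+ 2)%R)%R = 1)%E],
      forall n, (0 < n)%N ->
        upper_expectation Q (fun w => phi (normalized_sum X n w)) = 1%E &
      forall (d' : measure_display) (Omega' : measurableType d')
        (P' : probability Omega' R) (xi : {RV P' >-> R}),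
        (forall A, measurable A -> distribution P' xi A = normal_prob 0 1 A) ->
        ~ (upper_expectation Q (fun w => phi (normalized_sum X n w))
             @[n --> \oo] --> 'E_P'[fun w => phi (xi w)])%E].
Proof.
have [indX _] := iidX.
have mean n : (0 < n)%N ->
    upper_expectation Q (fun w => phi (normalized_sum X n w)) = 1%E.
  exact: upper_expectation_phi_normalized_sum.
split=> //.
  split.
  - apply: upper_expectation_calP_const => k k0.
    by rewrite expectation_Pk// /Xint mulrNz subrr !(mulr0, addr0).
  - apply: upper_expectation_calP_const => k k0.
    by rewrite expectation_Pk// /Xint mulrNz opprK addNr oppr0 !(mulr0, addr0).
  - by apply: upper_expectation_calP_const => k; exact: expectation_Pk_sqr.
  - rewrite (@upper_expectation_calP_const _ _ (-1)) ?EFinN ?oppeK// => k k0.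
    have := expectation_Pk_sqr R k0; rewrite !expectation_Pk// => -[h].
    by congr EFin; rewrite -[in RHS]h; ring.
move=> d' Omega' P' xi xiN cvg_phi.
have mabs : measurable_fun setT (fun w => `|xi w|) by exact: measurableT_comp.
have : ('E_P'[fun w => phi (xi w)] = 1)%E.
  apply: (cvg_unique _ cvg_phi) => //.
  by apply: cvg_near_cst; exists 1%N => // n; exact: mean.
rewrite (expectation_cB _ 1 mabs)// => E1.
apply: (normal_abs_expectation_neq0 xiN).
have := @expectation_ge0 _ _ _ P' (fun w => `|xi w|) (fun w => normr_ge0 _).
move: E1; case: ('E_P'[_])%E => [a| |]//=.
by rewrite -EFinB => -[a0] _; congr EFin; lra.
Qed.
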